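(* Let $1\le p<\infty$ and let $X$ be a real Banach space. If $F(X)$ has the Lipschitz approximation property, then $X$ has the Lipschitz $p$-approximation property.
   Context: $Lip_0(X,Y)$ is the space of Lipschitz maps $f:X\to Y$ with $f(0)=0$; $X^{\#}=Lip_0(X,\mathbb{R})$ with the best-Lipschitz-constant norm. The Lipschitz-free space is $F(X)=\overline{\mathrm{span}}^{\|\cdot\|}\{\delta_x:x\in X\}\subset (X^{\#})^*$, where $\delta_x(f)=f(x)$. For a Banach space $E$, $Lip_{0\mathcal{F}}(E,E)$ is the set of $f\in Lip_0(E,E)$ whose range spans a finite-dimensional subspace. A set $K\subset E$ is relatively $p$-compact if there is a sequence $(e_n)$ in $E$ with $\sum_n\|e_n\|^p<\infty$ and $K\subset\{\sum_n a_ne_n:(a_n)\in B_{\ell_{p'}}\}$, $p'$ the conjugate exponent of $p$; a $p$-compact set is a closed relatively $p$-compact set. $\tau_c$ and $\tau_p$ are the topologies of uniform convergence on compact and on $p$-compact subsets, respectively. $E$ has the Lipschitz approximation property if $Id_E\in\overline{Lip_{0\mathcal{F}}(E,E)}^{\tau_c}$, and the Lipschitz $p$-approximation property if $Id_E\in\overline{Lip_{0\mathcal{F}}(E,E)}^{\tau_p}$. *)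

(* Defs.v *)
From HB Require Import structures.
From mathcomp Require Import all_boot all_order all_algebra.
From mathcomp Require Import all_classical all_reals all_analysis.

Set Implicit Arguments.
Unset Strict Implicit.
Unset Printing Implicit Defensive.

Import Order.TTheory GRing.Theory Num.Theory.
Import numFieldNormedType.Exports.

Local Open Scope classical_set_scope.
Local Open Scope ring_scope.

Section span.
Context {R : realType} {V : normedModType R}.

Definition span (A : set V) : set V :=
  [set v | exists n (a : 'I_n -> R) (x : 'I_n -> V),
     (forall i, A (x i)) /\ v = \sum_(i < n) a i *: x i].

Definition finite_dimensional (S : set V) : Prop :=
  exists s : seq V, S = span [set` s].

Lemma span0 (A : set V) : span A 0.
Proof.
exists 0%N, (fun=> 0), (fun=> 0); split; first by case.
by rewrite big_ord0.
Qed.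

Lemma spanD (A : set V) u v : span A u -> span A v -> span A (u + v).
Proof.
move=> [n [a [x [Ax ->]]]] [m [b [y [Ay ->]]]].
exists (n + m)%N, (fun i : 'I_(n + m) => match fintype.split i with inl j => a j | inr k => b k end),
  (fun i : 'I_(n + m) => match fintype.split i with inl j => x j | inr k => y k end).
split=> [i|]; first by case: (fintype.split i).
rewrite big_split_ord /=; congr (_ + _); apply: eq_bigr => i _.
  by rewrite (unsplitK (inl i)).
by rewrite (unsplitK (inr i)).
Qed.

Lemma spanZ (A : set V) c u : span A u -> span A (c *: u).
Proof.
move=> [n [a [x [Ax ->]]]]; exists n, (fun i => c * a i), x; split => //.
by rewrite scaler_sumr; apply: eq_bigr => i _; rewrite scalerA.
Qed.

End span.

Section lip0.
Context {R : realType}.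

Definition Lip0 (X Y : normedModType R) : set (X -> Y) :=
  [set f | lipschitz f /\ f 0 = 0].

Definition Lip0F (X Y : normedModType R) : set (X -> Y) :=
  [set f | Lip0 f /\ finite_dimensional (span (range f))].

Lemma klipschitzP (X Y : normedModType R) (k : R) (f : X -> Y) :
  k.-lipschitz f <-> forall x y, `|f x - f y| <= k * `|x - y|.
Proof.
split=> [H x y|H [x y] _]; last exact: H.
exact: (H (x, y)).
Qed.

Lemma lipschitz_exP (X Y : normedModType R) (f : X -> Y) :
  lipschitz f <-> exists2 k, 0 <= k & k.-lipschitz f.
Proof.
split=> [fl|[k _ kf]]; last first.
  have P0 : ([set: X] `*` [set: X]) (0, 0) by [].
  exact: (klipschitzW (PF := globally_properfilter P0)) kf.
near (pinfty_nbhs R) => M; exists M.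
  by near: M; exact: nbhs_pinfty_ge.
by near: M; exact: fl.
Unshelve. all: by end_near. Qed.

End lip0.

Section lip_dual.
Context {R : realType} (X : normedModType R).

(* X^#, as a subtype of X -> R so that it can carry the norm lip_norm. *)
Definition lip0_pred : {pred X -> R^o} := mem (@Lip0 R X R^o).

Record lip_dual : Type :=
  LipDual { lip_dual_fun :> X -> R^o ; _ : lip_dual_fun \in lip0_pred }.

HB.instance Definition _ := [isSub for lip_dual_fun].
HB.instance Definition _ := [Choice of lip_dual by <:].

Lemma lip0_submod_closed : submod_closed lip0_pred.
Proof.
split=> [|a f g].
  apply/mem_set; split => //; apply/lipschitz_exP; exists 0 => //.
  by apply/klipschitzP => x y; rewrite subrr normr0 mul0r.
move=> /set_mem [/lipschitz_exP[k k0 /klipschitzP kf] f0].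
move=> /set_mem [/lipschitz_exP[l l0 /klipschitzP lg] g0].
apply/mem_set; split; last first.
  by rewrite -[LHS]/(a *: f 0 + g 0) f0 g0 scaler0 addr0.
apply/lipschitz_exP; exists (`|a| * k + l).
  by rewrite addr_ge0// mulr_ge0.
apply/klipschitzP => x y.
rewrite -[X in `|X|]/((a *: f x + g x) - (a *: f y + g y)).
rewrite opprD addrACA -scalerBr mulrDl (le_trans (ler_normD _ _))//.
by rewrite lerD// normrZ -mulrA ler_wpM2l.
Qed.

HB.instance Definition _ :=
  GRing.isSubmodClosed.Build _ _ lip0_pred lip0_submod_closed.
HB.instance Definition _ := [SubChoice_isSubLmodule of lip_dual by <:].

Implicit Types f g : lip_dual.

(* The infimum is attained, see lip_normP; the condition 0 <= k only matters
   when X is trivial. *)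
Definition lip_norm f : R := inf [set k | 0 <= k /\ k.-lipschitz f].

Lemma lip_dualP f : lipschitz f /\ f 0 = 0.
Proof. by case: f => f /= /set_mem. Qed.

Let lip_norm_has_inf f : has_inf [set k | 0 <= k /\ k.-lipschitz f].
Proof.
split; last by exists 0 => k [].
by have [/lipschitz_exP[k k0 kf] _] := lip_dualP f; exists k.
Qed.

Lemma lip_norm_ge0 f : 0 <= lip_norm f.
Proof. by apply: lb_le_inf => [|k []//]; case: (lip_norm_has_inf f). Qed.

Lemma lip_normP f x y : `|f x - f y| <= lip_norm f * `|x - y|.
Proof.
have [->|xy] := eqVneq x y; first by rewrite !subrr !normr0 mulr0.
have xy0 : 0 < `|x - y| by rewrite normr_gt0 subr_eq0.
rewrite -ler_pdivrMr//; apply: lb_le_inf.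
  by case: (lip_norm_has_inf f).
by move=> k [_ /klipschitzP kf]; rewrite ler_pdivrMr.
Qed.

Lemma lip_norm_le f k : 0 <= k -> (forall x y, `|f x - f y| <= k * `|x - y|) ->
  lip_norm f <= k.
Proof.
move=> k0 kf; apply: ge_inf; first by case: (lip_norm_has_inf f).
by split => //; apply/klipschitzP.
Qed.

Lemma lip_normD f g : lip_norm (f + g) <= lip_norm f + lip_norm g.
Proof.
apply: lip_norm_le => [|x y]; first by rewrite addr_ge0// lip_norm_ge0.
rewrite -[X in `|X|]/((f x + g x) - (f y + g y)).
rewrite opprD addrACA mulrDl (le_trans (ler_normD _ _))//.
by rewrite lerD// lip_normP.
Qed.

Let lip_normZ_le a f : lip_norm (a *: f) <= `|a| * lip_norm f.
Proof.
apply: lip_norm_le => [|x y]; first by rewrite mulr_ge0// lip_norm_ge0.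
rewrite -[X in `|X|]/(a *: f x - a *: f y) -scalerBr normrZ -mulrA.
by rewrite ler_wpM2l// lip_normP.
Qed.

Lemma lip_normZ a f : lip_norm (a *: f) = `|a| * lip_norm f.
Proof.
apply/eqP; rewrite eq_le lip_normZ_le/=.
have [->|a0] := eqVneq a 0; first by rewrite normr0 mul0r lip_norm_ge0.
rewrite -ler_pdivlMl ?normr_gt0// -normfV.
by rewrite -[in leLHS](scalerK a0 f) lip_normZ_le.
Qed.

Lemma lip_norm0_eq0 f : lip_norm f = 0 -> f = 0.
Proof.
move=> nf0; apply/val_inj/funext => x /=.
have := lip_normP f x 0; have [_ ->] := lip_dualP f.
by rewrite nf0 mul0r subr0 normr_le0 => /eqP.
Qed.

HB.instance Definition _ :=
  @Lmodule_isNormed.Build R lip_dual _ lip_normD lip_normZ lip_norm0_eq0.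

End lip_dual.

Section dual.
Context {R : realType} (V : normedModType R).

Definition dual_pred : {pred V -> R^o} :=
  mem [set phi : V -> R^o | linear phi /\ continuous phi].

Record dual : Type :=
  Dual { dual_fun :> V -> R^o ; _ : dual_fun \in dual_pred }.

HB.instance Definition _ := [isSub for dual_fun].
HB.instance Definition _ := [Choice of dual by <:].

Lemma dual_submod_closed : submod_closed dual_pred.
Proof.
split=> [|a f g].
  apply/mem_set; split=> [b x y|x]; first by rewrite scaler0 addr0.
  exact: cvg_cst.
move=> /set_mem [lf cf] /set_mem [lg cg].
apply/mem_set; split=> [b x y|x].
  rewrite -[LHS]/(a *: f (b *: x + y) + g (b *: x + y)) lf lg.
  rewrite -[RHS]/(b *: (a *: f x + g x) + (a *: f y + g y)).
  by rewrite !scalerDr addrACA !scalerA [b * a]mulrC.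
by apply: cvgD; [apply: cvgZl_tmp; exact: cf|exact: cg].
Qed.

HB.instance Definition _ :=
  GRing.isSubmodClosed.Build _ _ dual_pred dual_submod_closed.
HB.instance Definition _ := [SubChoice_isSubLmodule of dual by <:].

Implicit Types phi psi : dual.

Definition dual_norm phi : R := sup [set `|phi x| | x in [set x | `|x| <= 1]].

Lemma dual_linear phi : linear phi.
Proof. by case: phi => phi /= /set_mem[]. Qed.

Lemma dual_continuous phi : continuous phi.
Proof. by case: phi => phi /= /set_mem[]. Qed.

Let dual0 phi : phi 0 = 0.
Proof.
have /(congr1 (fun t => t - phi 0)) := dual_linear phi 1 0 0.
by rewrite !scale1r addr0 addrK subrr.
Qed.

Let dualZ phi a x : phi (a *: x) = a *: phi x.
Proof. by have := dual_linear phi a x 0; rewrite dual0 !addr0. Qed.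

Let dual_norm_has_sup phi :
  has_sup [set `|phi x| | x in [set x | `|x| <= 1]].
Proof.
split; first by exists `|phi 0|, 0 => //=; rewrite normr0.
pose phiM := GRing.isLinear.Build _ _ _ _ _ (dual_linear phi).
pose phiL : {linear V -> R^o} := HB.pack (dual_fun phi) phiM.
have [k k0 kphi] := @linear_lipschitz R V R^o phiL (@dual_continuous phi).
exists k => _ [x /= x1 <-]; rewrite (le_trans (kphi x))//.
by rewrite -[leRHS]mulr1 ler_wpM2l// ltW.
Qed.

Lemma dual_norm_ge0 phi : 0 <= dual_norm phi.
Proof.
apply: (@le_trans _ _ `|phi 0|) => //.
apply: ub_le_sup; first by case: (dual_norm_has_sup phi).
by exists 0 => //=; rewrite normr0.
Qed.

Lemma dual_normP phi x : `|phi x| <= dual_norm phi * `|x|.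
Proof.
have [->|x0] := eqVneq x 0; first by rewrite dual0 !normr0 mulr0.
have x0' : 0 < `|x| by rewrite normr_gt0.
rewrite -ler_pdivrMr//.
apply: ub_le_sup; first by case: (dual_norm_has_sup phi).
exists (`|x|^-1 *: x); last by rewrite dualZ normrZ normfV normr_id mulrC.
by rewrite /= normrZ normfV normr_id mulVf// gt_eqF.
Qed.

Lemma dual_norm_le phi k : 0 <= k -> (forall x, `|phi x| <= k * `|x|) ->
  dual_norm phi <= k.
Proof.
move=> k0 kphi; apply: ge_sup; first by case: (dual_norm_has_sup phi).
move=> _ [x /= x1 <-]; rewrite (le_trans (kphi x))//.
by rewrite -[leRHS]mulr1 ler_wpM2l.
Qed.

Lemma dual_normD phi psi : dual_norm (phi + psi) <= dual_norm phi + dual_norm psi.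
Proof.
apply: dual_norm_le => [|x]; first by rewrite addr_ge0// dual_norm_ge0.
rewrite -[X in `|X|]/(phi x + psi x) mulrDl (le_trans (ler_normD _ _))//.
by rewrite lerD// dual_normP.
Qed.

Let dual_normZ_le a phi : dual_norm (a *: phi) <= `|a| * dual_norm phi.
Proof.
apply: dual_norm_le => [|x]; first by rewrite mulr_ge0// dual_norm_ge0.
rewrite -[X in `|X|]/(a *: phi x) normrZ -mulrA.
by rewrite ler_wpM2l// dual_normP.
Qed.

Lemma dual_normZ a phi : dual_norm (a *: phi) = `|a| * dual_norm phi.
Proof.
apply/eqP; rewrite eq_le dual_normZ_le/=.
have [->|a0] := eqVneq a 0; first by rewrite normr0 mul0r dual_norm_ge0.
rewrite -ler_pdivlMl ?normr_gt0// -normfV.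
by rewrite -[in leLHS](scalerK a0 phi) dual_normZ_le.
Qed.

Lemma dual_norm0_eq0 phi : dual_norm phi = 0 -> phi = 0.
Proof.
move=> nf0; apply/val_inj/funext => x /=.
by have := dual_normP phi x; rewrite nf0 mul0r normr_le0 => /eqP.
Qed.

HB.instance Definition _ :=
  @Lmodule_isNormed.Build R dual _ dual_normD dual_normZ dual_norm0_eq0.

Lemma dual_complete (F : set_system dual) : ProperFilter F -> cauchy F -> cvg F.
Proof.
move=> FF /cauchy_ballP Fc.
have Fcx x : cvg ((fun phi : dual => phi x : R^o) @ F).
  apply: cauchy_cvg; apply/cauchy_ballP => e e0.
  have d0 : 0 < e / (`|x| + 1) by rewrite divr_gt0// ltr_wpDl.
  have [[A B] /= [FA FB] AB] := Fc _ d0.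
  exists ((fun phi : dual => phi x : R^o) @` A,
          (fun phi : dual => phi x : R^o) @` B) => /=.
    by split; [apply: filterS FA|apply: filterS FB] => phi; exists phi.
  move=> [_ _] /= [[phi Aphi <-] [psi Bpsi <-]].
  have := AB (phi, psi) (conj Aphi Bpsi).
  rewrite -!ball_normE /= => phipsi.
  apply: (le_lt_trans (dual_normP (phi - psi) x)).
  have x1 : 0 < `|x| + 1 by rewrite ltr_wpDl.
  apply: (@le_lt_trans _ _ (`|phi - psi| * (`|x| + 1))).
    by rewrite -[dual_norm _]/(`|phi - psi|) ler_wpM2l// lerDl.
  by rewrite -ltr_pdivlMr.
pose g (x : V) : R^o := lim ((fun phi : dual => phi x : R^o) @ F).
have gF x : (fun phi : dual => phi x : R^o) @ F --> g x by exact: Fcx.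
have lg : linear g.
  move=> a x y; apply: cvg_lim => //.
  have : (fun phi : dual => a *: (phi x : R^o) + phi y) @ F --> a *: g x + g y.
    by apply: cvgD; [apply: cvgZl_tmp|]; exact: gF.
  apply: cvg_trans; apply: near_eq_cvg; apply: nearW => phi.
  by rewrite dual_linear.
have Fg e : 0 < e ->
    F [set phi : dual | forall x, `|phi x - g x| <= e * `|x|].
  move=> e0; have [[A B] /= [FA FB] AB] := Fc _ e0.
  apply: filterS FA => phi Aphi x.
  have cphi : (fun psi : dual => `|phi x - psi x| : R^o) @ F --> `|phi x - g x|.
    by apply: cvg_norm; apply: cvgB; [exact: cvg_cst|exact: gF].
  rewrite -(cvg_lim _ cphi)//.
  apply: limr_le; first by apply/cvg_ex; exists `|phi x - g x|.
  apply: filterS FB => psi Bpsi.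
  have := AB (phi, psi) (conj Aphi Bpsi).
  rewrite -ball_normE /= => phipsi.
  apply: (le_trans (dual_normP (phi - psi) x)).
  by rewrite -[dual_norm _]/(`|phi - psi|) ler_wpM2r// ltW.
have [phi0 phi0g] := filter_ex (Fg 1 ltr01).
have gb x : `|g x| <= (dual_norm phi0 + 1) * `|x|.
  rewrite -[g x](subKr (phi0 x)) (le_trans (ler_normB _ _))//.
  by rewrite mulrDl lerD// dual_normP.
have cg : continuous g.
  pose gM := GRing.isLinear.Build _ _ _ _ _ lg.
  pose gL : {linear V -> R^o} := HB.pack g gM.
  apply: (@bounded_linear_continuous _ _ _ gL); apply/linear_boundedP.
  apply: filterS (nbhs_pinfty_ge (num_real (dual_norm phi0 + 1))) => r rge x.
  by rewrite (le_trans (gb x))// ler_wpM2r.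
have gP : g \in dual_pred by apply/mem_set; split.
apply/cvg_ex; exists (Dual gP); apply/cvgrPdist_le => e e0.
apply: filterS (Fg e e0) => phi phig.
apply: dual_norm_le => [|x]; first exact: ltW.
by rewrite -[X in `|X|]/(g x - phi x) distrC.
Qed.

HB.instance Definition _ := Uniform_isComplete.Build dual dual_complete.

End dual.

Section closed_span.
Context {R : realType} {V : completeNormedModType R} (A : set V).

Definition closed_span_pred : {pred V} := mem (closure (span A)).

Record closed_span : Type :=
  ClosedSpan { closed_span_val :> V ; _ : closed_span_val \in closed_span_pred }.

HB.instance Definition _ := [isSub for closed_span_val].
HB.instance Definition _ := [Choice of closed_span by <:].

Lemma closed_span_submod_closed : submod_closed closed_span_pred.
Proof.
split=> [|a u v]; first by apply/mem_set/subset_closure/span0.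
move=> /set_mem cu /set_mem cv; apply/mem_set => B /nbhs_ballP[e /= e0 eB].
have a1 : 0 < `|a| + 1 by rewrite ltr_wpDl.
have d0 : 0 < e / 2 / (`|a| + 1) by rewrite !divr_gt0.
have [u' [Au' uu']] := cu _ (nbhsx_ballx u _ d0).
have e20 : 0 < e / 2 by rewrite divr_gt0.
have [v' [Av' vv']] := cv _ (nbhsx_ballx v _ e20).
exists (a *: u' + v'); split; first by apply: spanD => //; exact: spanZ.
apply: eB; move: uu' vv'; rewrite -!ball_normE/= => uu' vv'.
rewrite opprD addrACA -scalerBr (le_lt_trans (ler_normD _ _))//.
rewrite [ltRHS]splitr ler_ltD// normrZ.
rewrite (@le_trans _ _ ((`|a| + 1) * `|u - u'|))//.
  by rewrite ler_wpM2r// lerDl.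
by rewrite mulrC -ler_pdivlMr// ltW.
Qed.

HB.instance Definition _ :=
  GRing.isSubmodClosed.Build _ _ closed_span_pred closed_span_submod_closed.
HB.instance Definition _ := [SubChoice_isSubLmodule of closed_span by <:].

Definition closed_span_norm (u : closed_span) : R := `|val u|.

Let normD u v :
  closed_span_norm (u + v) <= closed_span_norm u + closed_span_norm v.
Proof. exact: ler_normD. Qed.

Let normZ a u : closed_span_norm (a *: u) = `|a| * closed_span_norm u.
Proof. exact: normrZ. Qed.

Let norm0_eq0 u : closed_span_norm u = 0 -> u = 0.
Proof. by move=> /normr0_eq0 u0; exact: val_inj. Qed.

HB.instance Definition _ :=
  @Lmodule_isNormed.Build R closed_span _ normD normZ norm0_eq0.

Lemma closed_span_complete (F : set_system closed_span) :
  ProperFilter F -> cauchy F -> cvg F.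
Proof.
move=> FF /cauchy_ballP Fc.
have cF : cvg ((val u : V) @[u --> F]).
  apply: cauchy_cvg; apply/cauchy_ballP => e e0.
  have [[B C] /= [FB FC] BC] := Fc _ e0.
  exists (val @` B, val @` C) => /=.
    by split; [apply: filterS FB|apply: filterS FC] => u; exists u.
  move=> [_ _] /= [[u Bu <-] [v Cv <-]].
  have := BC (u, v) (conj Bu Cv).
  by rewrite -!ball_normE.
have lP : lim ((val u : V) @[u --> F]) \in closed_span_pred.
  apply/mem_set; apply: (closed_cvg (closure (span A)) _ _ _ cF) => //.
    exact: closed_closure.
  by apply: nearW => -[u /= /set_mem].
apply/cvg_ex; exists (ClosedSpan lP); apply/cvgrPdist_le => e e0.
by have /cvgrPdist_le /(_ e e0) := cF.
Qed.

HB.instance Definition _ :=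
  Uniform_isComplete.Build closed_span closed_span_complete.

End closed_span.

Section lipschitz_free.
Context {R : realType} (X : normedModType R).

Lemma eval_continuous (x : X) : continuous (fun f : lip_dual X => f x : R^o).
Proof.
move=> f; apply/(@cvgrPdist_lt _ _ _ _ (nbhs_filter f)) => e e0.
have x1 : 0 < `|x| + 1 by rewrite ltr_wpDl.
have d0 : 0 < e / (`|x| + 1) by rewrite divr_gt0.
apply: filterS (nbhsx_ballx f _ d0) => g.
rewrite -ball_normE /= ltr_pdivlMr//; apply: le_lt_trans.
have := lip_normP (f - g) x 0; have [_ ->] := lip_dualP (f - g).
rewrite !subr0 => /le_trans; apply.
by rewrite ler_wpM2l ?lerDl// lip_norm_ge0.
Qed.

Lemma eval_dual (x : X) :
  (fun f : lip_dual X => f x) \in @dual_pred R (lip_dual X).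
Proof. by apply/mem_set; split=> //; exact: eval_continuous. Qed.

Definition delta (x : X) : dual (lip_dual X) := Dual (eval_dual x).

Definition lipschitz_free : completeNormedModType R := closed_span (range delta).

End lipschitz_free.

Section approximation_properties.
Context {R : realType}.

(* B_{l_q}, for an extended exponent q; for q = +oo the essential supremum over
   the counting measure is the supremum. *)
Definition lq_ball (q : \bar R) : set (nat -> R) :=
  [set a | ('N[counting]_q [EFin \o a] <= 1)%E].

Definition relatively_p_compact (p : R) {E : normedModType R} (K : set E) :=
  exists e : nat -> E,
    cvgn (series (fun n => `|e n| `^ p)) /\
    K `<=` [set x | exists2 a, lq_ball (hoelder_conjugate p%:E) a &
                      series (fun n => a n *: e n) @ \oo --> x].

Definition p_compact (p : R) {E : normedModType R} (K : set E) :=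
  closed K /\ relatively_p_compact p K.

Definition lipschitz_AP (E : completeNormedModType R) : Prop :=
  closure (@Lip0F _ E E : set {family compact, E -> E}) idfun.

Definition lipschitz_p_AP (p : R) (E : completeNormedModType R) : Prop :=
  closure (@Lip0F _ E E : set {family p_compact p, E -> E}) idfun.

End approximation_properties.

(* Main.v *)
Require Import Defs.
From HB Require Import structures.
From mathcomp Require Import all_boot all_order all_algebra.
From mathcomp Require Import all_classical all_reals all_analysis.
From mathcomp Require Import ess_sup_inf.
From mathcomp Require Import lra.

Set Implicit Arguments.
Unset Strict Implicit.
Unset Printing Implicit Defensive.

Import Order.TTheory GRing.Theory Num.Theory.
Import numFieldNormedType.Exports.

Local Open Scope ring_scope.
Local Open Scope classical_set_scope.

(** Write F(X) for the Lipschitz-free space. The isometric embedding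
    delta : X -> F(X) has a linear left inverse beta : F(X) -> X of norm at most
    one, the barycenter map, so a Lipschitz approximation f of the identity of
    F(X) descends to the approximation beta \o f \o delta of the identity of X.
    This map is Lipschitz and vanishes at 0, and its range lies in the image
    under beta of the range of f, hence spans a finite-dimensional space. If f is
    e-close to the identity on delta(K), then beta \o f \o delta is e-close to
    the identity on K = beta(delta(K)). Since delta is continuous, the only thing
    left to know about a p-compact set K is that it is compact.

    The barycenter of u is the point x such that u(f) = f(x) for all linear f in
    X^#. By Hahn-Banach (norming_functional) it satisfies |x| <= |u|, hence is
    unique and depends on u in a linear and 1-Lipschitz way. It exists for finite
    combinations of the delta_x, and then for their limits because X is complete
    (barycenter_of_closure).

    For the compactness of p-compact sets (p_compact_compact), write each point
    of K as \sum_n a_n e_n with a in the unit ball of l_p'. Hoelder's inequality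
    bounds the tails uniformly over K by those of \sum_n |e_n|^p, and the
    finitely many remaining coefficients live in [-1, 1]; so along an ultrafilter
    on K all coefficients converge, the ultrafilter is Cauchy, and it converges
    in K since K is closed. *)

Local Notation span := Defs.span.

(** * Norming functionals *)

Section sublinear.
Context {R : realType} {V : lmodType R}.
Implicit Types (q : V -> R) (x y : V).

Definition sublinear q :=
  (forall x y, q (x + y) <= q x + q y) /\
  (forall t x, 0 < t -> q (t *: x) <= t * q x).

Lemma sublinear0 q : sublinear q -> q 0 = 0.
Proof.
move=> [qD qZ]; have := qD 0 0; rewrite addr0 => q0.
have h0 : 0 < 2^-1 :> R by rewrite invr_gt0.
have := qZ 2^-1 0 h0; rewrite scaler0 => q1.
by lra.
Qed.

Lemma sublinearZ q t x : sublinear q -> 0 <= t -> q (t *: x) = t * q x.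
Proof.
move=> sq; rewrite le_eqVlt => /predU1P[<-|t0].
  by rewrite scale0r sublinear0// mul0r.
have [_ qZ] := sq; apply/eqP; rewrite eq_le qZ//= -ler_pdivlMl//.
rewrite -[in leLHS](@scalerK _ V _ (lt0r_neq0 t0) x).
by apply: qZ; rewrite invr_gt0.
Qed.

Lemma sublinear_lb q x : sublinear q -> - q (- x) <= q x.
Proof.
by move=> sq; have [/(_ x (- x))] := sq; rewrite subrr sublinear0//; lra.
Qed.

(** The pointwise infimum of a family of functions is sublinear as soon as the
    family satisfies the inequalities of sublinearity up to a change of index.
    This covers both the infimum of a chain of sublinear functionals and the
    slope infimum below. *)
Lemma sublinear_inf (I : Type) (F : I -> V -> R) :
  inhabited I ->
  (forall x, has_lbound (range (F^~ x))) ->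
  (forall i j x y, exists k, F k (x + y) <= F i x + F j y) ->
  (forall i t x, 0 < t -> exists k, F k (t *: x) <= t * F i x) ->
  sublinear (fun x => inf (range (F^~ x))).
Proof.
move=> [i0] Flb FD FZ.
have Fne x : range (F^~ x) !=set0 by exists (F i0 x), i0.
have leF i x : inf (range (F^~ x)) <= F i x by apply: ge_inf => //; exists i.
split=> [x y|t x t0].
  rewrite -lerBlDr; apply: lb_le_inf => // _ [i _ <-].
  rewrite lerBlDr -lerBlDl; apply: lb_le_inf => // _ [j _ <-].
  rewrite lerBlDl; have [k kij] := FD i j x y.
  by rewrite (le_trans (leF k _)).
rewrite -ler_pdivrMl//; apply: lb_le_inf => // _ [i _ <-].
have [k ki] := FZ i t x t0.
by rewrite ler_pdivrMl// (le_trans (leF k _)).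
Qed.

(** The infimum over t >= 0 of q (x + t y) - t q(y): a sublinear functional below
    q that is as small as possible in the direction y, in that its value at -y is
    at most - q(y). *)
Definition slope_inf q y x :=
  inf (range (fun t : {t : R | 0 <= t} => q (x + sval t *: y) - sval t * q y)).

Lemma slope_inf_lb q y x : sublinear q ->
  has_lbound
    (range (fun t : {t : R | 0 <= t} => q (x + sval t *: y) - sval t * q y)).
Proof.
move=> sq; exists (- q (- x)) => _ [[t t0] _ <-] /=.
rewrite -sublinearZ//; have [/(_ (x + t *: y) (- x)) + _] := sq.
by rewrite addrAC subrr add0r; lra.
Qed.

Lemma slope_inf_le q y t x : sublinear q -> 0 <= t ->
  slope_inf q y x <= q (x + t *: y) - t * q y.
Proof.
move=> sq t0; apply: ge_inf; first exact: slope_inf_lb.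
by exists (exist _ t t0).
Qed.

Lemma slope_inf_le_self q y x : sublinear q -> slope_inf q y x <= q x.
Proof.
move=> sq; have := slope_inf_le y x sq (lexx 0).
by rewrite scale0r addr0 mul0r subr0.
Qed.

Lemma slope_inf_sublinear q y : sublinear q -> sublinear (slope_inf q y).
Proof.
move=> sq; have [qD _] := sq; apply: sublinear_inf.
- by constructor; exists 0; exact: lexx.
- by move=> x; exact: slope_inf_lb.
- move=> [s s0] [t t0] x z; exists (exist _ (s + t) (addr_ge0 s0 t0)) => /=.
  rewrite scalerDl addrACA mulrDl.
  by have := qD (x + s *: y) (z + t *: y); lra.
- move=> [s s0] t x t0; exists (exist _ (t * s) (mulr_ge0 (ltW t0) s0)) => /=.
  by rewrite -scalerA -scalerDr (sublinearZ _ sq (ltW t0)) mulrBr mulrA.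
Qed.

(** If q is minimal then it equals each slope_inf q y; taking t = 1 in the
    infimum gives q x + q y <= q (x + y), so q is additive. *)
Lemma minimal_sublinear_linear q : sublinear q ->
  (forall r, sublinear r -> (forall x, r x <= q x) -> r = q) ->
  linear (q : V -> R^o).
Proof.
move=> sq qmin.
have qD x y : q (x + y) = q x + q y.
  apply/eqP; rewrite eq_le (proj1 sq)/=.
  have <- : slope_inf q y x + q y = q x + q y.
    congr (_ + _); move: x; apply/funeqP/qmin; first exact: slope_inf_sublinear.
    by move=> x; exact: slope_inf_le_self.
  have := slope_inf_le y x sq ler01.
  by rewrite scale1r mul1r lerBrDr.
have qN x : q (- x) = - q x.
  by apply/eqP; rewrite -addr_eq0 addrC -qD subrr sublinear0.
move=> a x y; rewrite qD; congr (_ + _).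
have [a0|a0] := leP 0 a; first exact: sublinearZ.
rewrite -[a]opprK scaleNr qN sublinearZ ?oppr_ge0 ?ltW//.
by rewrite -mulNr opprK.
Qed.

(** Zorn's lemma for the reverse pointwise order: a chain is bounded by its
    pointwise infimum, which is finite since q x >= - q (- x) >= - p (- x) for
    all its members q. *)
Lemma exists_minimal_sublinear p : sublinear p -> exists q,
  [/\ sublinear q, forall x, q x <= p x &
      forall r, sublinear r -> (forall x, r x <= q x) -> r = q].
Proof.
move=> sp.
pose T := {q : V -> R | sublinear q /\ forall x, q x <= p x}.
have Teq (s t : T) : sval s = sval t -> s = t.
  by case: s t => [s sP] [t tP] /= st; exact: eq_exist.
pose le (s t : T) := `[< forall x, sval t x <= sval s x >].
have [||||[q [sq qp]] qmin] := @Zorn T le.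
- by move=> s; apply/asboolP.
- move=> r s t /asboolP rs /asboolP st; apply/asboolP => x.
  exact: le_trans (rs x).
- move=> s t /asboolP st /asboolP ts; apply/Teq/funext => x.
  by apply/eqP; rewrite eq_le st ts.
- move=> A Atot; have [[s0 As0]|A0] := pselect (A !=set0); last first.
    exists (exist _ p (conj sp (fun=> lexx _))) => s As.
    by exfalso; apply: A0; exists s.
  pose F (s : {s | A s}) x := sval (sval s) x.
  have Flb x : has_lbound (range (F^~ x)).
    exists (- p (- x)) => _ [[[s [ss sp']] As] _ <-]; rewrite /F /=.
    by rewrite (le_trans _ (sublinear_lb x ss))// lerN2.
  have sF : sublinear (fun x => inf (range (F^~ x))).
    apply: sublinear_inf => //.
    + by constructor; exists s0.
    + move=> [s As] [t At] x y; rewrite /F /=.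
      have [[sD _] _] := svalP s; have [[tD _] _] := svalP t.
      have [/asboolP st|/asboolP ts] := Atot _ _ As At.
        exists (exist _ t At) => /=; rewrite (le_trans (tD _ _))//.
        by rewrite lerD2r.
      exists (exist _ s As) => /=; rewrite (le_trans (sD _ _))//.
      by rewrite lerD2l.
    + move=> [[s [ss sp']] As] t x t0; rewrite /F /=.
      by exists (exist _ (exist _ s (conj ss sp')) As) => /=; exact: (proj2 ss).
  have Fp x : inf (range (F^~ x)) <= p x.
    rewrite (@le_trans _ _ (sval s0 x))//; last by case: s0 {As0} => s [].
    by apply: ge_inf => //; exists (exist _ s0 As0).
  exists (exist _ (fun x => inf (range (F^~ x))) (conj sF Fp)) => s As.
  apply/asboolP => x /=.
  by apply: ge_inf => //; exists (exist _ s As).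
- exists q; split=> // r sr rq.
  have rp x : r x <= p x by exact: le_trans (qp x).
  suff /(congr1 sval) : exist _ r (conj sr rp) = exist _ q (conj sq qp) :> T.
    by [].
  by apply: qmin; apply/asboolP.
Qed.

End sublinear.

(** A minimal sublinear functional below slope_inf of the norm at z is linear and
    below the norm. It also is at most - |z| at -z, hence reaches |z| at z. *)
Lemma norming_functional {R : realType} {X : normedModType R} (z : X) :
  exists phi : X -> R^o,
    [/\ linear phi, forall x, `|phi x| <= `|x| & phi z = `|z|].
Proof.
have sN : sublinear (fun x : X => `|x|).
  by split=> [x y|t x t0]; [exact: ler_normD|rewrite normrZ gtr0_norm].
have [q [sq qle qmin]] :=
  exists_minimal_sublinear (slope_inf_sublinear z sN).
have lq := minimal_sublinear_linear sq qmin.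
have qN x : q (- x) = - q x.
  by have := lq (-1) x 0; rewrite !addr0 (sublinear0 sq) addr0 !scaleN1r.
have qnorm x : q x <= `|x|.
  exact: le_trans (qle x) (slope_inf_le_self _ _ sN).
exists q; split=> // [x|].
  by rewrite ler_norml qnorm andbT lerNl -qN -normrN qnorm.
apply/eqP; rewrite eq_le qnorm /= -lerN2 -qN (le_trans (qle _))//.
have := slope_inf_le z (- z) sN ler01.
by rewrite scale1r addNr normr0 mul1r sub0r.
Qed.

(** * Spans and finite dimension *)

Section finite_dimensional.
Context {R : realType} {V : normedModType R}.
Implicit Types A : set V.

Lemma subset_span A : A `<=` span A.
Proof.
move=> v Av; exists 1%N, (fun=> 1), (fun=> v).
by rewrite big_ord1 scale1r.
Qed.

Lemma span_least A (W : set V) :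
  W 0 -> (forall a u v, W u -> W v -> W (a *: u + v)) ->
  A `<=` W -> span A `<=` W.
Proof.
move=> W0 WL AW _ [n [a [x [Ax ->]]]].
by elim/big_rec: _ => // i u _; exact: WL (AW _ (Ax i)).
Qed.

Lemma span_linear A a u v : span A u -> span A v -> span A (a *: u + v).
Proof. by move=> Au Av; apply: spanD => //; exact: spanZ. Qed.

Lemma span_sub A B : A `<=` span B -> span A `<=` span B.
Proof.
by apply: span_least; [exact: span0|move=> a u v; exact: span_linear].
Qed.

Lemma span_cons v (s : seq V) u : span [set` v :: s] u ->
  exists c, span [set` s] (u - c *: v).
Proof.
move: u; apply: span_least.
- by exists 0; rewrite scale0r subr0; exact: span0.
- move=> a x y [c sx] [d sy]; exists (a * c + d).
  have -> : a *: x + y - (a * c + d) *: v = a *: (x - c *: v) + (y - d *: v).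
    by rewrite scalerBr scalerDl opprD addrACA scalerA.
  exact: span_linear.
- move=> u; rewrite /= inE => /predU1P[->|us].
    by exists 1; rewrite scale1r subrr; exact: span0.
  by exists 0; rewrite scale0r subr0; exact: subset_span.
Qed.

(** Induction on the spanning sequence v :: s. Generators t of the part of W in
    the span of s are given by induction; if some w in W has a nonzero coefficient
    along v, then subtracting multiples of w brings any vector of W into that
    part, so that w :: t spans W. *)
Lemma subspace_finite_dimensional (s : seq V) (W : set V) :
  W 0 -> (forall a u v, W u -> W v -> W (a *: u + v)) ->
  W `<=` span [set` s] -> finite_dimensional W.
Proof.
elim: s W => [|v s IH] W W0 WL Ws.
  exists [::]; apply/seteqP; split=> //; apply: span_least => //.
have [] := IH (W `&` span [set` s]).
- by split => //; exact: span0.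
- by move=> a x y [Wx sx] [Wy sy]; split; [exact: WL|exact: span_linear].
- by move=> x [].
move=> t Wt.
have tW : [set` t] `<=` W `&` span [set` s] by rewrite Wt; exact: subset_span.
have [[w [c [Ww c0 wc]]]|Wn] := pselect (exists w c,
    [/\ W w, c != 0 & span [set` s] (w - c *: v)]); last first.
  exists t; rewrite -Wt; apply/seteqP; split=> [u Wu|u []//].
  split => //; have [c uc] := span_cons (Ws _ Wu).
  have [c0|c0] := eqVneq c 0; first by move: uc; rewrite c0 scale0r subr0.
  by exfalso; apply: Wn; exists u, c.
exists (w :: t); apply/seteqP; split; last first.
  apply: span_least => // u; rewrite /= inE => /predU1P[->//|ut].
  by have [] := tW _ ut.
move=> u Wu; have [d ud] := span_cons (Ws _ Wu).
rewrite -(subrK ((d / c) *: w) u) addrC; apply: span_linear.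
  by apply: subset_span; rewrite /= mem_head.
have tw : [set` t] `<=` span [set` w :: t].
  by move=> x xt; apply: subset_span; rewrite /= inE xt orbT.
apply: (span_sub tw); rewrite -Wt; split.
  by rewrite addrC -scaleNr; exact: WL.
have -> : u - (d / c) *: w = (- (d / c)) *: (w - c *: v) + (u - d *: v).
  rewrite scalerBr scalerA mulNr divfK// !scaleNr opprK.
  by rewrite [RHS]addrC (addrC (- _) (d *: v)) addrA subrK.
exact: span_linear.
Qed.

End finite_dimensional.

Lemma finite_dimensional_linear_image {R : realType} {V W : normedModType R}
    (h : V -> W) (A : set V) (B : set W) :
  linear h -> finite_dimensional (span A) -> B `<=` h @` A ->
  finite_dimensional (span B).
Proof.
move=> lh [s As] BA.
have h0 : h 0 = 0.
  by have := lh (-1) 0 0; rewrite scaler0 addr0 scaleN1r addNr.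
apply: (@subspace_finite_dimensional _ _ [seq h x | x <- s]).
- exact: span0.
- by move=> a u v; exact: span_linear.
apply: span_sub => _ /BA[x Ax <-].
have : span [set` s] x by rewrite -As; exact: subset_span.
move: x {Ax}; apply: span_least => [|a u v su sv|x xs].
- by rewrite /= h0; exact: span0.
- by rewrite /= lh; exact: span_linear.
- by apply: subset_span; rewrite /= map_f.
Qed.

(** * Barycenters in the Lipschitz-free space *)

Section barycenter.
Context {R : realType} (X : completeNormedModType R).
Implicit Types (u v : dual (lip_dual X)) (x y : X).

(** Testing u against the linear elements of X^# only determines x, and does so
    without choosing a representation of u as a combination of the delta_x. *)
Definition barycenter_of u x :=
  forall f : lip_dual X, linear f -> u f = f x.

Lemma barycenter_of_linear a u v x y :
  barycenter_of u x -> barycenter_of v y ->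
  barycenter_of (a *: u + v) (a *: x + y).
Proof. by move=> ux vy f lf; rewrite lf -ux// -vy. Qed.

Lemma barycenter_of0 : barycenter_of 0 0.
Proof. by move=> f _; have [_ ->] := lip_dualP f. Qed.

Lemma barycenter_of_delta x : barycenter_of (delta x) x.
Proof. by []. Qed.

Lemma linear_lip_dual (phi : X -> R^o) :
  linear phi -> (forall x, `|phi x| <= `|x|) ->
  exists f : lip_dual X, [/\ f = phi :> (X -> R^o), linear f & `|f| <= 1].
Proof.
move=> lphi phile.
have phiB x y : phi x - phi y = phi (x - y).
  by have := lphi (-1) y x; rewrite !scaleN1r !(addrC (- _)).
have phi1 x y : `|phi x - phi y| <= 1 * `|x - y| by rewrite mul1r phiB.
have phiP : phi \in @lip0_pred R X.
  apply/mem_set; split; last by rewrite -(subrr 0) -phiB subrr.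
  by apply/lipschitz_exP; exists 1 => //; apply/klipschitzP.
by exists (LipDual phiP); split => //; exact: lip_norm_le.
Qed.

(** Test u against a norming functional of x, which has norm at most one in
    X^#. *)
Lemma barycenter_of_norm u x : barycenter_of u x -> `|x| <= `|u|.
Proof.
move=> ux; have [phi [lphi phile phix]] := norming_functional x.
have [f [fphi lf f1]] := linear_lip_dual lphi phile.
have := ux f lf; rewrite fphi phix => <-.
rewrite (le_trans (ler_norm _))// (le_trans (dual_normP u f))//.
by rewrite -[dual_norm u]/(`|u|) -[leRHS]mulr1 ler_wpM2l.
Qed.

Lemma barycenter_of_dist u v x y : barycenter_of u x -> barycenter_of v y ->
  `|x - y| <= `|u - v|.
Proof.
move=> ux vy; rewrite (addrC x) (addrC u) -(scaleN1r y) -(scaleN1r v).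
exact: barycenter_of_norm (barycenter_of_linear _ vy ux).
Qed.

Lemma barycenter_of_uniq u x y :
  barycenter_of u x -> barycenter_of u y -> x = y.
Proof.
move=> ux uy; apply/eqP; rewrite -subr_eq0 -normr_le0.
by rewrite (le_trans (barycenter_of_dist ux uy))// subrr normr0.
Qed.

Lemma barycenter_of_span u : span (range (@delta R X)) u ->
  exists x, barycenter_of u x.
Proof.
move: u; apply: span_least.
- by exists 0; exact: barycenter_of0.
- move=> a u v [x ux] [y vy]; exists (a *: x + y).
  exact: barycenter_of_linear.
- by move=> _ [x _ <-]; exists x; exact: barycenter_of_delta.
Qed.

(** By barycenter_of_dist, a filter on S that converges to u is mapped to a
    Cauchy filter by barycenters; its limit is a barycenter of u because both
    sides of the defining equation are continuous. *)
Lemma barycenter_of_closure (S : set (dual (lip_dual X))) u :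
  (forall v, S v -> exists x, barycenter_of v x) ->
  closure S u -> exists x, barycenter_of u x.
Proof.
move=> Sb; rewrite closureEcvg => -[G GG [Gu GS]].
pose b v : X := xget 0 [set x | barycenter_of v x].
have {GS}Gb : G [set v | barycenter_of v (b v)].
  by apply: GS => v /Sb; exact: xgetPex.
have : cvg (b @ G).
  apply: cauchy_cvg; apply/cauchy_ballP => e e0.
  have e20 : 0 < e / 2 by rewrite divr_gt0.
  pose B := [set v | barycenter_of v (b v) /\ ball u (e / 2) v].
  have GB : G B by apply: filterI => //; exact/Gu/nbhsx_ballx.
  exists (b @` B, b @` B) => /=.
    by split; exact: filterS (@preimage_image _ _ b B) GB.
  move=> [_ _] /= [[v [vb uv] <-] [w [wb uw] <-]].
  have := ball_splitr uv uw; rewrite -!ball_normE /=.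
  exact/le_lt_trans/barycenter_of_dist.
move=> /cvg_ex[x bx]; exists x => f lf.
have vf : (v f : R^o) @[v --> G] --> (u f : R^o).
  apply/cvgrPdist_le => e e0.
  have f1 : 0 < `|f| + 1 by rewrite ltr_wpDl.
  have d0 : 0 < e / (`|f| + 1) by rewrite divr_gt0.
  apply: filterS (Gu _ (nbhsx_ballx u _ d0)) => v.
  rewrite -ball_normE /= => /ltW uv.
  rewrite (le_trans (dual_normP (u - v) f))//.
  rewrite (@le_trans _ _ (e / (`|f| + 1) * (`|f| + 1)))//; last first.
    by rewrite divfK// gt_eqF.
  by apply: ler_pM => //; [exact: dual_norm_ge0|rewrite lerDl].
have fb : (f (b v) : R^o) @[v --> G] --> (f x : R^o).
  apply/cvgrPdist_le => e e0.
  have f1 : 0 < `|f| + 1 by rewrite ltr_wpDl.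
  have d0 : 0 < e / (`|f| + 1) by rewrite divr_gt0.
  move/cvgrPdist_le : bx => /(_ _ d0); apply: filterS => v xbv.
  rewrite (le_trans (lip_normP f _ _))//.
  rewrite (@le_trans _ _ ((`|f| + 1) * (e / (`|f| + 1))))//; last first.
    by rewrite mulrC divfK// gt_eqF.
  by apply: ler_pM => //; [exact: lip_norm_ge0|rewrite lerDl].
apply: (cvg_unique (@norm_hausdorff _ R^o) vf); apply: cvg_trans fb.
apply: (@near_eq_cvg _ _ G _ (fun v => f (b v) : R^o) (fun v => v f : R^o)).
by apply: filterS Gb => v /= vb; rewrite (vb f lf).
Qed.

Lemma lipschitz_free_barycenter (u : lipschitz_free X) :
  exists x, barycenter_of (val u) x.
Proof.
case: u => u /= /set_mem; apply: barycenter_of_closure.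
exact: barycenter_of_span.
Qed.

Definition barycenter (u : lipschitz_free X) : X :=
  sval (cid (lipschitz_free_barycenter u)).

Lemma barycenterP (u : lipschitz_free X) : barycenter_of (val u) (barycenter u).
Proof. by rewrite /barycenter; case: cid. Qed.

Lemma barycenter_linear : linear barycenter.
Proof.
move=> a u v; apply: barycenter_of_uniq (barycenterP _) _.
exact: barycenter_of_linear (barycenterP u) (barycenterP v).
Qed.

Lemma barycenter_dist (u v : lipschitz_free X) :
  `|barycenter u - barycenter v| <= `|u - v|.
Proof. exact: barycenter_of_dist (barycenterP u) (barycenterP v). Qed.

Lemma delta_closed_span x :
  delta x \in @closed_span_pred R (dual (lip_dual X)) (range (@delta R X)).
Proof. by apply/mem_set/subset_closure/subset_span; exists x. Qed.

(** The map delta with values in F(X) rather than in the dual of X^#. *)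
Definition free_delta x : lipschitz_free X := ClosedSpan (delta_closed_span x).

Lemma free_deltaK : cancel free_delta barycenter.
Proof.
move=> x; apply: barycenter_of_uniq (barycenterP _) _.
exact: barycenter_of_delta.
Qed.

Lemma free_delta_dist x y : `|free_delta x - free_delta y| <= `|x - y|.
Proof.
apply: dual_norm_le => // f.
by rewrite [leRHS]mulrC; exact: lip_normP.
Qed.

Lemma free_delta0 : free_delta 0 = 0.
Proof.
apply/val_inj/val_inj/funext => f /=.
by have [_] := lip_dualP f.
Qed.

Lemma free_delta_continuous : continuous free_delta.
Proof.
move=> x; apply/cvgrPdist_le => e e0.
apply: filterS (nbhsx_ballx x _ e0) => y; rewrite -ball_normE /= => /ltW.
exact/le_trans/free_delta_dist.
Qed.

End barycenter.

(** * Hoelder's inequality for coefficients in the unit ball of l_p' *)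

Section lq_ball.
Context {R : realType}.
Implicit Types (p : R) (a w : nat -> R).

(** For the counting measure, only the empty set is negligible, so the essential
    supremum bounds every term. *)
Lemma lq_ball_le1 a n : lq_ball +oo a -> `|a n| <= 1.
Proof.
rewrite /lq_ball /= unlock.
have cT : (0 < @counting nat R setT)%E.
  rewrite /counting asboolF; first exact: lt0y.
  exact: infinite_nat.
rewrite cT => /ess_supP [A [mA A0 sA]].
rewrite leNgt; apply/negP => a1.
have An : [set n] `<=` A.
  by move=> _ ->; apply: sA => /=; rewrite lee_fin leNgt a1.
have : (@counting nat R [set n] <= counting A)%E.
  by apply: le_measure; rewrite ?inE.
by rewrite A0 /counting asboolT// fset_set1 finmap.cardfs1 lee_fin ler10.
Qed.

Lemma Lnorm_counting_support p (g : nat -> R) N M : 0 < p ->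
  (forall k, ~~ (N <= k < M)%N -> g k = 0) ->
  'N[counting]_(p%:E) [EFin \o g]%E =
  ((\sum_(N <= k < M) `|g k| `^ p) `^ p^-1)%:E.
Proof.
move=> p0 g0; rewrite Lnorm_counting//.
have h0 k : (0 <= `|(EFin \o g) k| `^ p)%E by exact: poweR_ge0.
rewrite (@nneseries_split _ _ 0 M)// add0n.
rewrite ereal_series_cond eseries0 ?adde0; last first.
  move=> k _ /andP[Mk _] /=.
  rewrite g0 ?normr0 ?powR0 ?gt_eqF//.
 by apply/negP => /andP[_]; rewrite ltnNge Mk.
rewrite -poweR_EFin; congr (_ `^ _)%E; rewrite sumEFin; congr EFin.
rewrite [RHS](big_nat_widenl _ 0%N)//= [RHS]big_mkcond/=.
rewrite [LHS]big_nat [RHS]big_nat.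
apply: eq_bigr => k kM; case: ifPn => // Nk.
by rewrite g0 ?(negPf Nk)// normr0 powR0// gt_eqF.
Qed.

(** Hoelder's inequality for finite sums, including the extreme case p = 1. *)
Lemma lq_ball_hoelder p a w N M : 1 <= p ->
  lq_ball (hoelder_conjugate p%:E) a -> (forall n, 0 <= w n) ->
  \sum_(N <= k < M) `|a k| * w k <= (\sum_(N <= k < M) w k `^ p) `^ p^-1.
Proof.
rewrite le_eqVlt => /predU1P[<-|p1] la w0.
  rewrite hoelder_conjugate1 in la.
  rewrite invr1 powRr1; last by apply: sumr_ge0 => k _; exact: powR_ge0.
  apply: ler_sum => k _; rewrite powRr1//.
  by rewrite -[leRHS]mul1r ler_wpM2r// lq_ball_le1.
have p0 : 0 < p by rewrite (lt_trans ltr01).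
have pm1 : 0 < p - 1 by rewrite subr_gt0.
pose q := p / (p - 1).
have q0 : 0 < q by rewrite divr_gt0.
have qE : hoelder_conjugate p%:E = q%:E.
  rewrite /hoelder_conjugate /= gt_eqF ?lte_fin//.
  by rewrite -EFinD inver gt_eqF.
have qp : q^-1 + p^-1 = 1.
  by rewrite /q invf_div -[X in _ + X]mul1r -mulrDl subrK divff// gt_eqF.
(* Truncating w turns the inequality between l_p norms into one between the
   finite sums. *)
pose g k := if (N <= k < M)%N then w k else 0.
have gE k : (N <= k < M)%N -> g k = w k by rewrite /g => ->.
have g0 k : ~~ (N <= k < M)%N -> g k = 0 by rewrite /g => /negPf ->.
have ma : measurable_fun setT a by [].
have mg : measurable_fun setT g by [].
have := hoelder counting ma mg q0 p0 qp.
rewrite (@Lnorm_counting_support 1 _ N M)//; last first.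
  by move=> k kNM /=; rewrite g0// mulr0.
rewrite (Lnorm_counting_support p0 g0) invr1.
rewrite powRr1; last by apply: sumr_ge0 => k _; exact: powR_ge0.
have -> : \sum_(N <= k < M) `|(a \* g) k| `^ 1 = \sum_(N <= k < M) `|a k| * w k.
  rewrite big_nat [RHS]big_nat; apply: eq_bigr => k kNM.
  by rewrite powRr1//= gE// normrM (ger0_norm (w0 k)).
have -> : \sum_(N <= k < M) `|g k| `^ p = \sum_(N <= k < M) w k `^ p.
  rewrite big_nat [RHS]big_nat; apply: eq_bigr => k kNM.
  by rewrite gE// ger0_norm.
move=> /le_trans h; rewrite -lee_fin; apply: h.
rewrite -[leRHS]mul1e; apply: lee_wpmul2r; first by rewrite lee_fin powR_ge0.
by move: la; rewrite /lq_ball /= qE.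
Qed.

Lemma lq_ball_conjugate_le1 p a n : 1 <= p ->
  lq_ball (hoelder_conjugate p%:E) a -> `|a n| <= 1.
Proof.
move=> p1 la.
(* the inequality for a sum reduced to its n-th term *)
have := @lq_ball_hoelder p a (fun=> 1) n n.+1 p1 la (fun=> ler01).
by rewrite !big_nat1 mulr1 !powR1.
Qed.

End lq_ball.

(** * Compactness of p-compact sets *)

Lemma ultra_fmap {T U : Type} (f : T -> U) (F : set_system T) :
  UltraFilter F -> UltraFilter (f @ F).
Proof.
move=> FU; split; first exact: fmap_proper_filter.
move=> G GG FG; apply/seteqP; split=> // A GA.
have [//|FnA] := in_ultra_setVsetC (f @^-1` A) FU.
have /filter_ex[x []//] : G (A `&` ~` A).
by apply: filterI => //; exact: FG.
Qed.

Lemma cvg_sum {R : realType} {E : normedModType R} {T : Type}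
    {F : set_system T} {FF : Filter F} (I : Type) (r : seq I)
    (f : I -> T -> E) (l : I -> E) :
  (forall i, f i @ F --> l i) ->
  \sum_(i <- r) f i x @[x --> F] --> \sum_(i <- r) l i.
Proof.
move=> fl; elim: r => [|i r IH].
  by rewrite big_nil; under eq_fun do rewrite big_nil; exact: cvg_cst.
by rewrite big_cons; under eq_fun do rewrite big_cons; exact: cvgD.
Qed.

Section p_compact.
Context {R : realType} {E : completeNormedModType R}.
Implicit Types (p : R) (e : nat -> E) (a : nat -> R).

(** The bound depends on the e_k only, not on the coefficients: this uniformity
    is what makes the set of all such sums totally bounded. *)
Lemma lq_ball_series_tail p e a x N eta : 1 <= p -> 0 <= eta ->
  lq_ball (hoelder_conjugate p%:E) a ->
  series (fun n => a n *: e n) @ \oo --> x ->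
  (forall M, \sum_(N <= k < M) `|e k| `^ p <= eta `^ p) ->
  `|x - series (fun n => a n *: e n) N| <= eta.
Proof.
move=> p1 eta0 la ax etaP; set S := series _.
have p0 : 0 < p by rewrite (lt_le_trans ltr01).
have cS : `|S M - S N| @[M --> \oo] --> `|x - S N|.
  by apply: cvg_norm; apply: cvgB => //; exact: cvg_cst.
rewrite -(cvg_lim _ cS)//; apply: limr_le.
  by apply/cvg_ex; exists `|x - S N|.
near=> M.
have NM : (N <= M)%N by near: M; exact: nbhs_infty_ge.
rewrite sub_series_geq// (le_trans (ler_norm_sum _ _ _))//.
rewrite (eq_bigr (fun k => `|a k| * `|e k|)) => [|k _]; last exact: normrZ.
rewrite (le_trans (lq_ball_hoelder _ _ p1 la _))//.
rewrite -[leRHS](powRr1 eta0) -(mulfV (lt0r_neq0 p0)) powRrM.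
by apply: ge0_ler_powR; rewrite ?invr_ge0 ?(ltW p0)// nnegrE ?sumr_ge0// => *;
  exact: powR_ge0.
Unshelve. all: by end_near. Qed.

Lemma small_tail p e eta : 0 < eta ->
  cvgn (series (fun n => `|e n| `^ p)) ->
  exists N, forall M, \sum_(N <= k < M) `|e k| `^ p <= eta `^ p.
Proof.
move=> eta0 /cvg_cauchy/cauchy_seriesP/(_ (eta `^ p) (powR_gt0 p eta0)).
case=> -[A B] /= [[N _ NA] [M0 _ MB]] AB; exists N => M.
apply: (@le_trans _ _ (\sum_(N <= k < maxn M M0) `|e k| `^ p)).
  have [NM|MN] := leqP N M; last first.
    rewrite big_geq ?(ltnW MN)//.
    by apply: sumr_ge0 => k _; exact: powR_ge0.
  rewrite [leRHS](big_cat_nat (n := M)) ?leq_maxl//= lerDl.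
  by apply: sumr_ge0 => k _; exact: powR_ge0.
rewrite (le_trans (ler_norm _))// ltW//.
by apply: (AB (N, maxn M M0)); split;
  [exact: NA (leqnn N)|exact: MB (leq_maxr M M0)].
Qed.

(** Along an ultrafilter on K the coefficients of its points converge, one index
    at a time, to some b_n; the ultrafilter is Cauchy because for each eps a
    truncation \sum_(k < N) b_k e_k is the center of an eps-ball in it. *)
Lemma p_compact_compact p (K : set E) : 1 <= p -> p_compact p K -> compact K.
Proof.
move=> p1 [Kc [e [ecvg Ke]]]; rewrite compact_ultra => F FU FK.
have /choice[coef coefP] (x : E) : exists a, K x ->
    lq_ball (hoelder_conjugate p%:E) a /\
    series (fun n => a n *: e n) @ \oo --> x.
  have [/Ke[a la ax]|Kx] := pselect (K x); first by exists a.
  by exists (fun=> 0) => /Kx.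
have /choice[b bP] n : exists bn : R, coef x n @[x --> F] --> bn.
  have F1 : F [set x | `[-1, 1]%classic (coef x n)].
    apply: filterS FK => x /coefP[lx _] /=.
    by rewrite in_itv /= -ler_norml (lq_ball_conjugate_le1 _ p1 lx).
  have := @segment_compact R (-1) 1; rewrite compact_ultra.
  move=> /(_ _ (ultra_fmap (fun x => coef x n) FU) F1)[bn [_ bP]].
  by exists bn.
have : cvg F.
  apply: cauchy_cvg; apply: cauchy_exP => eps eps0.
  have eps2 : 0 < eps / 2 by rewrite divr_gt0.
  have [N NP] := small_tail eps2 ecvg.
  pose c := \sum_(0 <= k < N) b k *: e k.
  have cF : series (fun n => coef x n *: e n) N @[x --> F] --> c.
    rewrite /series /=; apply: cvg_sum => k.
    exact: cvgZr_tmp.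
  exists c; move/cvgrPdist_lt : cF => /(_ _ eps2) cF.
  apply: filterS (filterI FK cF) => x [Kx cx].
  have [lx sx] := coefP x Kx.
  have := lq_ball_series_tail p1 (ltW eps2) lx sx NP.
  rewrite -ball_normE /= distrC => xN.
  rewrite -(subrK (series (fun n => coef x n *: e n) N) c) -addrA.
  by rewrite (le_lt_trans (ler_normD _ _))// [ltRHS]splitr ltr_leD.
move=> /cvg_ex[x Fx]; exists x; split=> //.
by apply: Kc => B /Fx FB; exact: filter_ex (filterI FK FB).
Qed.

End p_compact.

(** * Descent of approximations from F(X) to X *)

Section transport.
Context {R : realType} (X : completeNormedModType R).

Definition transport (f : lipschitz_free X -> lipschitz_free X) : X -> X :=
  @barycenter R X \o f \o @free_delta R X.

Lemma transport_id : transport idfun = idfun.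
Proof. by apply/funext => x; exact: free_deltaK. Qed.

Lemma transport_Lip0F f : Lip0F f -> Lip0F (transport f).
Proof.
move=> [[/lipschitz_exP[k k0 /klipschitzP kf] f0] fd].
have b0 : barycenter (0 : lipschitz_free X) = 0.
  by rewrite -(@free_delta0 R X) free_deltaK.
split; first split.
- apply/lipschitz_exP; exists k => //; apply/klipschitzP => x y.
  rewrite (le_trans (barycenter_dist _ _))// (le_trans (kf _ _))//.
  by rewrite ler_wpM2l// free_delta_dist.
- by rewrite /transport /= free_delta0 f0 b0.
- apply: finite_dimensional_linear_image (@barycenter_linear R X) fd _.
  by move=> _ [x _ <-]; exists (f (free_delta x)) => //; exists (free_delta x).
Qed.

(** If K is p-compact then delta(K) is compact, and the barycenter map being
    1-Lipschitz, the distance to the identity does not increase from delta(K) to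
    K. *)
Lemma transport_cvg (p : R)
    (F : set_system (lipschitz_free X -> lipschitz_free X)) :
  1 <= p -> Filter F ->
  {family compact, F --> idfun} ->
  {family p_compact p, transport @ F --> idfun}.
Proof.
move=> p1 FF /fam_cvgP Fid; apply/fam_cvgP => K /(p_compact_compact p1) cK.
have cdK : compact (@free_delta R X @` K).
  apply: continuous_compact => //; apply: continuous_subspaceT.
  exact: free_delta_continuous.
move=> P /uniform_nbhs[B [+ BP]].
rewrite -entourage_ballE => -[e /= e0 eB].
have FP : nbhs (idfun : {uniform` (@free_delta R X @` K) -> lipschitz_free X})
    [set f | forall u, (@free_delta R X @` K) u -> ball u e (f u)].
  apply/uniform_nbhs; exists [set uv | ball uv.1 e uv.2]; split=> //.
  exact: entourage_ball (PosNum e0).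
move: (Fid _ cdK _ FP); apply: filterS => f fe; apply: BP => x Kx; apply: eB => /=.
have := fe (free_delta x) (ex_intro2 _ _ x Kx erefl).
rewrite -!ball_normE /= -[X in _ -> `|X - _| < e](free_deltaK x).
exact/le_lt_trans/barycenter_dist.
Qed.

End transport.

Theorem proposition3p8 (R : realType) (p : R) (X : completeNormedModType R) :
  1 <= p -> lipschitz_AP (lipschitz_free X) -> lipschitz_p_AP p X.
Proof.
rewrite /lipschitz_AP /lipschitz_p_AP !closureEcvg => p1 [F FF [Fid FL]].
exists (@transport R X @ F); first exact: fmap_proper_filter.
split; first exact: transport_cvg.
by move=> A LA; apply: FL => f /transport_Lip0F/LA.
Qed.
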